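(* Let $A$ be a nonsingular $d\times d$ integer matrix and let $w\in\mathbb{R}^d$. Then for every integer $n\geq 1$, $$\sum_{\xi\in T_A^*}\langle w,\cos(2\pi\xi)\rangle^n=\frac{|\det A|}{2^n}\sum_{x\in A\mathbb{Z}^d}\ \sum_{y\in \mathscr{P}\left(\frac{n-|x|}{2},d\right)}\frac{n!}{(\mathrm{abs}(x)+y)!\,y!}\,w^{\mathrm{abs}(x)+2y}.$$
   Context: Here $T_A^*=(A^{T})^{-1}\mathbb{Z}^d/\mathbb{Z}^d$ (a finite quotient group). For $\xi\in T_A^*$, $\cos(2\pi\xi):=(\cos(2\pi\xi_1),\dots,\cos(2\pi\xi_d))\in\mathbb{R}^d$ (computed from any representative of $\xi$), and $\langle\cdot,\cdot\rangle$ is the standard inner product of $\mathbb{R}^d$. For $x\in\mathbb{Z}^d$: $\mathrm{abs}(x)=(|x_1|,\dots,|x_d|)$ and $|x|=\sum_{i=1}^d|x_i|$. For $x\in\mathbb{Z}_{\geq 0}^d$: $x!=x_1!x_2!\cdots x_d!$ and $w^x=w_1^{x_1}w_2^{x_2}\cdots w_d^{x_d}$ (with $0^0=1$). For $k\in\mathbb{Z}_{\geq 0}$, $\mathscr{P}(k,d)=\{x\in\mathbb{Z}_{\geq 0}^d : |x|=k\}$; when $k<0$ or $k\notin\mathbb{Z}$, $\mathscr{P}(k,d)=\emptyset$ (so only finitely many terms on the right-hand side are nonzero). *)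

(* Defs.v *)
From mathcomp Require Import all_boot all_order all_algebra.
From mathcomp Require Import all_classical all_reals all_analysis.

Set Implicit Arguments.
Unset Strict Implicit.
Unset Printing Implicit Defensive.

Import Order.TTheory GRing.Theory Num.Theory.

Local Open Scope classical_set_scope.
Local Open Scope ring_scope.

Section Torus.
Variables (R : realType) (d : nat).
Implicit Types (A : 'M[int]_d) (u v xi : 'cV[R]_d) (z : 'cV[int]_d).

Definition inner u v : R := \sum_(i < d) u i 0 * v i 0.

Definition cos2pi xi : 'cV[R]_d := \col_i cos (2 * pi * xi i 0).

(* The subgroup (A^T)^-1 Z^d of R^d. *)
Definition dual_lattice A : set 'cV[R]_d :=
  [set invmx (map_mx intr A)^T *m map_mx intr z | z in [set: 'cV[int]_d]].

Definition coset_Zd xi : set 'cV[R]_d :=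
  [set xi + map_mx intr z | z in [set: 'cV[int]_d]].

(* The elements of (A^T)^-1 Z^d / Z^d are cosets of Z^d, as subsets of R^d. *)
Definition T_star A : set (set 'cV[R]_d) := [set coset_Zd xi | xi in dual_lattice A].

(* cos2pi on a coset, through a chosen representative (0 on the empty set);
   by cos2pi_cosetE the choice is immaterial. *)
Definition cos2pi_coset (C : set 'cV[R]_d) : 'cV[R]_d := cos2pi (xget 0 C).

Lemma cos2piDz (xi : 'cV[R]_d) (z : 'cV[int]_d) :
  cos2pi (xi + map_mx intr z) = cos2pi xi.
Proof.
apply/matrixP => i j; rewrite !mxE mulrDr; case: (z i 0) => n /=.
  have -> : 2 * pi * (Posz n)%:~R = pi *+ 2 *+ n :> R.
    by rewrite -pmulrn mulr_natr mulr_natl.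
  by rewrite (periodicn (@cosD2pi R)).
have -> : 2 * pi * (Negz n)%:~R = - (pi *+ 2 *+ n.+1) :> R.
  by rewrite NegzE mulrNz mulrN -pmulrn mulr_natr mulr_natl.
by rewrite -[LHS](periodicn (@cosD2pi R) n.+1) subrK.
Qed.

Lemma cos2pi_cosetE (xi xi' : 'cV[R]_d) :
  coset_Zd xi xi' -> cos2pi_coset (coset_Zd xi) = cos2pi xi'.
Proof.
move=> xi'C; rewrite /cos2pi_coset.
have [z _ <-] := xgetPex 0 (ex_intro (coset_Zd xi) xi' xi'C).
by case: xi'C => z' _ <-; rewrite !cos2piDz.
Qed.

End Torus.

Arguments dual_lattice R {d} A _.
Arguments T_star R {d} A _.

Section Multiindex.
Variable d : nat.
Implicit Types (x : 'cV[int]_d) (y : 'cV[nat]_d).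

Definition lattice (A : 'M[int]_d) : set 'cV[int]_d :=
  [set A *m z | z in [set: 'cV[int]_d]].

Definition absv x : 'cV[nat]_d := map_mx absz x.

Definition norm1n y : nat := (\sum_(i < d) y i 0%R)%N.

Definition norm1 x : nat := norm1n (absv x).

(* For rational k: empty unless k is a nonnegative integer. *)
Definition weak_compositions (k : rat) : set 'cV[nat]_d :=
  [set y | (norm1n y)%:R = k].

Definition vfact y : nat := (\prod_(i < d) (y i 0%R)`!)%N.

Definition vpow (R : realType) (w : 'cV[R]_d) y : R :=
  \prod_(i < d) w i 0 ^+ y i 0.

End Multiindex.

Arguments weak_compositions d k _ : clear implicits.

(* These facts show that the finite-support sums over T_star, weak_compositions
   and lattice in the statement never take their default value. *)
Section Finiteness.
Variables (R : realType) (d : nat).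

Lemma finite_bounded_nvec (N : nat) :
  finite_set [set y : 'cV[nat]_d | forall i, (y i 0%R <= N)%N].
Proof.
pose f (v : 'cV['I_N.+1]_d) : 'cV[nat]_d := map_mx (@nat_of_ord _) v.
apply: (sub_finite_set _ (finite_image f (@finite_finset _ setT))) => y yN.
exists (\col_i inord (y i 0)) => //.
by apply/matrixP => i j; rewrite !mxE ord1 inordK // ltnS.
Qed.

Lemma finite_bounded_zvec (N : nat) :
  finite_set [set x : 'cV[int]_d | forall i, (`|x i 0%R|%N <= N)%N].
Proof.
pose f (v : 'cV[bool * 'I_N.+1]_d) : 'cV[int]_d :=
  map_mx (fun p : bool * 'I_N.+1 => if p.1 then - (p.2 : nat)%:Z else (p.2 : nat)%:Z) v.
apply: (sub_finite_set _ (finite_image f (@finite_finset _ setT))) => x xN.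
exists (\col_i (x i 0 < 0, inord `|x i 0%R|%N)) => //.
apply/matrixP => i j; rewrite !mxE ord1 /= inordK ?ltnS //.
by case: ltP => [/ltz0_abs ->|/gez0_abs //]; rewrite opprK.
Qed.

Lemma finite_weak_compositions (k : rat) : finite_set (weak_compositions d k).
Proof.
apply: (sub_finite_set _ (finite_bounded_nvec (Num.truncn k))) => y yk i /=.
rewrite -yk natrK /norm1n (bigD1 i) //=; exact: leq_addr.
Qed.

Lemma finite_weak_compositions_neq0 (n : nat) :
  finite_set [set x : 'cV[int]_d |
    weak_compositions d ((n%:R - (norm1 x)%:R) / 2) !=set0].
Proof.
apply: (sub_finite_set _ (finite_bounded_zvec n)) => x [y yE] i /=.
have : (norm1 x <= n)%N.
  rewrite -(@ler_nat rat) -subr_ge0.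
  have half0 : 0 < 2^-1 :> rat by rewrite invr_gt0.
  by rewrite -(pmulr_lge0 _ half0) -yE ler0n.
by apply: leq_trans; rewrite /norm1 /norm1n (bigD1 i) //= mxE leq_addr.
Qed.

Lemma finite_T_star (A : 'M[int]_d) : \det A != 0 -> finite_set (T_star R A).
Proof.
move=> A0; set D := \det A.
pose g (z : 'cV[int]_d) := coset_Zd (invmx (map_mx intr A)^T *m map_mx intr z : 'cV[R]_d).
apply: (sub_finite_set _ (finite_image g (finite_bounded_zvec `|D|%N))).
move=> _ [_ [z _ <-] <-].
pose r : 'cV[int]_d := map_mx (fun a => modz a D) z.
pose q : 'cV[int]_d := map_mx (fun a => divz a D) z.
have zE : z = A^T *m (\adj A^T *m q) + r.
  rewrite mulmxA mul_mx_adj det_tr mul_scalar_mx.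
  by apply/matrixP => i j; rewrite !mxE mulrC -divz_eq.
have AU : (map_mx intr A : 'M[R]_d)^T \in unitmx.
  by rewrite unitmx_tr unitmxE det_map_mx unitfE intr_eq0.
exists r => [i /=|].
  by rewrite mxE -lez_nat gez0_abs ?modz_ge0 //; apply/ltW/ltz_mod.
rewrite /g zE map_mxD map_mxM -map_trmx mulmxDr mulKmx //.
set u := _ *m q; set s := _ *m map_mx intr r.
rewrite eqEsubset; split => _ [t _ <-].
  exists (t - u) => //; rewrite map_mxB.
  by rewrite [_ + s]addrC -addrA [X in s + X]addrC subrK.
by exists (u + t) => //; rewrite map_mxD addrA [s + _]addrC.
Qed.

End Finiteness.

(* Main.v *)
(* Write 2 cos(2 pi t) = e(t) + e(-t) with e(t) = exp(2 pi i t) and expand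
   <w, 2 cos(2 pi xi)>^n by the multinomial theorem over the 2d terms
   w_i e(xi_i) and w_i e(-xi_i).  A term with exponents (a_i^+, a_i^-)
   contributes the character xi |-> e(<x, xi>), x = a^+ - a^-, and the sum of
   this character over T_A^* is |det A| if x lies in A Z^d and 0 otherwise.
   Putting y = min(a^+, a^-) gives {a_i^+, a_i^-} = {|x_i| + y_i, y_i}, hence
   the stated coefficients.  For the character sum, a Smith form A = L D U
   identifies T_A^* with prod_j Z/delta_j, and the sum factors into sums of
   powers of roots of unity. *)
Require Import Defs.
From mathcomp Require Import all_boot all_order all_algebra.
From mathcomp Require Import all_classical all_reals all_analysis.
From mathcomp Require Import complex zify ring lra.
Import Order.TTheory GRing.Theory Num.Theory.
Local Open Scope classical_set_scope.
Local Open Scope ring_scope.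

(** * Multinomial theorem *)

(* The multinomial coefficients are read off a product of truncated exponential
   series, so that only the binomial theorem is needed. *)
Lemma coef_prod_trunc_exp (F : numFieldType) (I : finType) (t : I -> F)
    (n k : nat) : (k <= n)%N ->
  (\prod_i \poly_(j < n.+1) (t i ^+ j / j`!%:R))`_k =
  (\sum_i t i) ^+ k / k`!%:R.
Proof.
have fact_neq0 m : m`!%:R != 0 :> F by rewrite pnatr_eq0 -lt0n fact_gt0.
elim/big_ind2: _ k => [k _|p x q y Hp Hq k kn|i _ k kn].
- by rewrite coef1 expr0n; case: k => [|k] /=; rewrite ?mul0r ?invr1 ?mul1r.
- rewrite coefM exprDn mulr_suml (reindex_inj rev_ord_inj) /=.
  apply: eq_bigr => j _.
  have jk : (j <= k)%N by rewrite -ltnS.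
  rewrite subSS subKn // Hp ?Hq ?(leq_trans jk)
    ?(leq_trans (leq_subr _ _) kn) //.
  rewrite -(bin_fact jk) !natrM -mulr_natr.
  have /negPf b0 : 'C(k, j)%:R != 0 :> F by rewrite pnatr_eq0 -lt0n bin_gt0.
  by field; rewrite b0 !fact_neq0.
- by rewrite coef_poly ltnS kn.
Qed.

Lemma multinomial_theorem (F : numFieldType) (I : finType) (t : I -> F)
    (n : nat) :
  (\sum_i t i) ^+ n =
  \sum_(a : {ffun I -> 'I_n.+1} | (\sum_i a i == n)%N)
    n`!%:R * \prod_i (t i ^+ a i / (a i)`!%:R).
Proof.
have fact_neq0 : n`!%:R != 0 :> F by rewrite pnatr_eq0 -lt0n fact_gt0.
rewrite -mulr_sumr; apply: (mulIf (invr_neq0 fact_neq0)).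
rewrite -(coef_prod_trunc_exp _ _ t _ _ (leqnn n)) mulrAC divff // mul1r.
under eq_bigr do rewrite poly_def.
(* Distributivity gives one monomial per exponent vector [a], of degree the sum of the [a i];
   extracting the coefficient of degree [n] yields the constraint on [a]. *)
rewrite bigA_distr_bigA coef_sum [RHS]big_mkcond /=; apply: eq_bigr => a _.
rewrite (scaler_prod _ _ _) prodrXr coefZ coefXn eq_sym.
by case: eqP => _; rewrite ?mulr1 ?mulr0.
Qed.

(** * The character e(t) = exp(2 pi i t) *)

Section Character.
Variable R : realType.
Implicit Types s t : R.
Local Open Scope complex_scope.

Definition expi2pi t : R[i] := cos (2 * pi * t) +i* sin (2 * pi * t).

Lemma expi2pi0 : expi2pi 0 = 1.
Proof. by rewrite /expi2pi mulr0 cos0 sin0. Qed.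

Lemma expi2piD s t : expi2pi (s + t) = expi2pi s * expi2pi t.
Proof.
apply/eqP; rewrite eq_complex /= mulrDr cosD sinD.
by rewrite [X in _ && (X == _)]addrC !eqxx.
Qed.

Lemma expi2pi_sum (I : finType) (f : I -> R) :
  expi2pi (\sum_i f i) = \prod_i expi2pi (f i).
Proof. by rewrite (big_morph _ expi2piD expi2pi0). Qed.

Lemma expi2piMn t n : expi2pi (t *+ n) = expi2pi t ^+ n.
Proof.
elim: n => [|n IH]; first by rewrite mulr0n expi2pi0.
by rewrite mulrS expi2piD IH exprS.
Qed.

Lemma expi2piDN t : expi2pi t + expi2pi (- t) = (2 * cos (2 * pi * t))%:C.
Proof.
rewrite /expi2pi mulrN cosN sinN; apply/eqP.
by rewrite eq_complex /= subrr -mulr2n -(mulr_natl (cos _)) !eqxx.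
Qed.

(** Subtracting the floor leaves 0 <= s < 1; the real part then gives 1 - 2 sin(pi s)^2 = 1,
    impossible for 0 < s < 1 because sin is positive on (0, pi). *)
Lemma expi2pi_eq1 t : expi2pi t = 1 <-> t \is a Num.int.
Proof.
have e1 : expi2pi 1 = 1.
  by rewrite /expi2pi mulr1 mulr_natl cos2pi sin2pi.
have en n : expi2pi n%:R = 1 by rewrite expi2piMn e1 expr1n.
have ez z : expi2pi z%:~R = 1.
  case: z => n; rewrite ?NegzE ?mulrNz; first exact: en.
  by have := expi2piD (- n.+1%:R) n.+1%:R; rewrite addNr expi2pi0 en mulr1.
split=> [|/intrP[z ->]//].
rewrite -{1}(subrK (Num.floor t)%:~R t) expi2piD ez mulr1.
set s := t - _ => /(congr1 (@complex.Re R)) /= cos1.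
have /andP[s0 s1] : 0 <= s < 1.
  rewrite subr_ge0 floor_le ltrBlDl.
  by have := floorD1_gt t; rewrite intrD.
have [s_gt0|] := ltP 0 s; last first.
  move=> s_le0; have /subr0_eq -> : s = 0 by apply/eqP; rewrite eq_le s_le0.
  exact: intr_int.
have ppos := pi_gt0 R.
have sin_pos : 0 < sin (pi * s).
  by apply: sin_gt0_pi; rewrite mulr_gt0 // gtr_pMr.
move: cos1; rewrite -mulrA mulr_natl cos_mulr2n cos2sin2.
move: sin_pos; nra.
Qed.
End Character.

(** * Smith form and coordinates on the dual torus *)

Lemma int_Smith_diag (d : nat) (A : 'M[int]_d) :
  exists L U (delta : 'rV[int]_d),
    [/\ L \in unitmx, U \in unitmx & A = L *m diag_mx delta *m U].
Proof.
have [L Lu [U Uu [s _ AE]]] := int_Smith_normal_form A.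
exists L, U, (\row_i s`_i); split=> //; rewrite {}AE; congr (_ *m _ *m _).
by apply/matrixP => i j; rewrite !mxE; congr (_ *+ _); case: eqVneq.
Qed.

Lemma coset_Zd_eqP (R : realType) (d : nat) (xi xi' : 'cV[R]_d) :
  coset_Zd xi = coset_Zd xi' <->
  exists z : 'cV[int]_d, xi = xi' + map_mx intr z.
Proof.
split=> [e|[z ->]].
  have : coset_Zd xi xi by exists 0 => //; rewrite map_mx0 addr0.
  by rewrite e => -[z _ <-]; exists z.
rewrite eqEsubset; split=> _ [t _ <-].
  by exists (z + t) => //; rewrite map_mxD addrA.
by exists (t - z) => //; rewrite map_mxB addrACA subrr addr0.
Qed.

(** Testing membership by integrality of A^T xi lets points be compared after multiplication by
    A^T. *)
Lemma dual_latticeP (R : realType) (d : nat) (A : 'M[int]_d) (xi : 'cV[R]_d) :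
  \det A != 0 ->
  dual_lattice R A xi <->
  exists z : 'cV[int]_d, map_mx intr A^T *m xi = map_mx intr z.
Proof.
move=> A0.
have AU : (map_mx intr A : 'M[R]_d)^T \in unitmx.
  by rewrite unitmx_tr unitmxE det_map_mx unitfE intr_eq0.
split=> [[z _ <-]|[z]]; first by exists z; rewrite -map_trmx mulKVmx.
by rewrite -map_trmx => e; exists z => //; rewrite -e mulKmx.
Qed.

Section DualTorus.
Variables (R : realType) (d : nat) (A L U : 'M[int]_d) (delta : 'rV[int]_d).
Hypotheses (Lu : L \in unitmx) (Uu : U \in unitmx).
Hypothesis AE : A = L *m diag_mx delta *m U.
Hypothesis A0 : \det A != 0.

(** [L] and [U] are invertible over the integers, so their determinants are 1 or -1. *)
Lemma Smith_diag_det : `|\det A|%N = (\prod_j `|delta 0%R j|)%N.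
Proof.
rewrite AE !det_mulmx det_diag !abszM.
have unit1 (B : 'M[int]_d) : B \in unitmx -> `|\det B|%N = 1%N.
  by rewrite unitmxE qualifE => /orP[] /eqP ->.
rewrite (unit1 _ Lu) (unit1 _ Uu) mul1n muln1.
by rewrite (big_morph absz abszM (erefl _)).
Qed.

Lemma Smith_diag_neq0 j : delta 0 j != 0.
Proof.
apply: contraNneq A0 => dj0.
by rewrite -absz_eq0 Smith_diag_det (bigD1 j) //= dj0 mul0n.
Qed.

(* (L^T)^-1 (k_j / delta_j)_j, a point of (A^T)^-1 Z^d since
   A^T = U^T diag(delta) L^T *)
Definition dual_rep (k : 'I_d -> nat) : 'cV[R]_d :=
  map_mx intr (invmx L)^T *m \col_j ((k j)%:R / (delta 0 j)%:~R).

Lemma mul_tr_dual_rep k :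
  map_mx intr A^T *m dual_rep k = map_mx intr (U^T *m \col_j (k j)%:Z).
Proof.
rewrite /dual_rep mulmxA -map_mxM -trmx_mul {1}AE !mulmxA mulVmx // mul1mx.
rewrite trmx_mul tr_diag_mx !map_mxM /= -mulmxA; congr (_ *m _).
apply/matrixP => i j; rewrite map_diag_mx mul_diag_mx !mxE.
by rewrite mulrC divfK // intr_eq0 Smith_diag_neq0.
Qed.

(** After multiplication by A^T, congruence of representatives modulo Z^d becomes coordinatewise
    congruence modulo [delta], and the [k j] run over reduced residues. The common bound [M] gives
    all coordinates the one type ['I_M]. *)
Lemma T_star_bij (M : nat) : (forall j, `|delta 0%R j| <= M)%N ->
  set_bij
    [set` [pred k : {ffun 'I_d -> 'I_M} | [forall j, k j < `|delta 0%R j|]%N]]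
    (T_star R A) (fun k => coset_Zd (dual_rep (fun j => k j))).
Proof.
have AtE : A^T = U^T *m (diag_mx delta *m L^T).
  by rewrite AE !trmx_mul tr_diag_mx.
have intr_inj_mx : injective (map_mx intr : 'cV[int]_d -> 'cV[R]_d).
  move=> x y /matrixP e; apply/matrixP => i j.
  by have := e i j; rewrite !mxE => /intr_inj.
have mul_tr_inj : injective (mulmx (map_mx intr A^T) : 'cV[R]_d -> 'cV[R]_d).
  apply: (can_inj (mulKmx _)).
  by rewrite unitmxE det_map_mx unitfE intr_eq0 det_tr.
have Utu : U^T \in unitmx by rewrite unitmx_tr.
move=> leM; split=> [k _|k k' /set_mem/= kP /set_mem/= k'P|_ [xi xiD <-]].
- exists (dual_rep (fun j => k j)) => //; apply/dual_latticeP => //.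
  by rewrite mul_tr_dual_rep; eexists.
- case/coset_Zd_eqP => z /(congr1 (mulmx (map_mx intr A^T))).
  rewrite mulmxDr !mul_tr_dual_rep -map_mxM -map_mxD => /intr_inj_mx.
  rewrite AtE -2!mulmxA -mulmxDr.
  move=> /(can_inj (mulKmx Utu)) e; apply/ffunP => j; apply/val_inj/eqP.
  rewrite -eqz_nat /=.
  move/matrixP/(_ j 0): e; rewrite mul_diag_mx !mxE => e.
  have small (l : {ffun 'I_d -> 'I_M}) : [forall j, (l j < `|delta 0%R j|)%N] ->
      ((l j)%:Z %% delta 0%R j)%Z = l j.
    by move=> /forallP/(_ j) ?; rewrite -modz_abs modz_small.
  by rewrite -(small k) // -(small k') // e addrC mulrC modzMDl.
- have /dual_latticeP-/(_ A0)[z zE] := xiD.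
  have [y zy] : exists y, z = U^T *m y.
    by exists (invmx U^T *m z); rewrite mulKVmx.
  (* Reducing [y] modulo [delta] gives the representative; the quotients, carried back by the
     inverse of L^T, give the integral shift. *)
  pose r : 'I_d -> nat := fun j => `|(y j 0%R %% delta 0%R j)%Z|%N.
  have r_lt j : (r j < `|delta 0%R j|)%N.
    rewrite -ltz_nat /r gez0_abs ?modz_ge0 ?Smith_diag_neq0 // abszE.
    by rewrite ltz_mod ?Smith_diag_neq0.
  have dM j : (r j < M)%N by apply: leq_trans (leM j).
  exists [ffun j => Ordinal (dM j)].
    by rewrite /= inE; apply/forallP => j; rewrite ffunE; exact: r_lt.
  apply/esym/coset_Zd_eqP.
  exists (invmx L^T *m \col_j (y j 0%R %/ delta 0%R j)%Z).
  apply: mul_tr_inj; rewrite zE mulmxDr mul_tr_dual_rep -map_mxM -map_mxD.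
  congr map_mx; rewrite AtE -mulmxA -mulmxDr -mulmxA mulKVmx ?unitmx_tr //.
  rewrite zy; congr (_ *m _).
  apply/matrixP => j i; rewrite mul_diag_mx !mxE ord1 ffunE /=.
  rewrite gez0_abs ?modz_ge0 ?Smith_diag_neq0 //.
  by rewrite addrC mulrC -divz_eq.
Qed.

End DualTorus.

(** * Character sums over the dual torus *)

Lemma sum_root_of_unity (F : idomainType) (q : F) (n : nat) : q ^+ n = 1 ->
  \sum_(i < n) q ^+ i = (if q == 1 then n%:R else 0).
Proof.
move=> qn1; case: eqP => [->|/eqP q1].
  by under eq_bigr do rewrite expr1n; rewrite sumr_const card_ord.
apply: (mulfI (_ : q - 1 != 0)); first by rewrite subr_eq0.
by rewrite -subrX1 qn1 subrr mulr0.
Qed.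

Lemma ratio_intP (R : realType) (a b : int) : b != 0 ->
  (a%:~R / b%:~R : R) \is a Num.int = (b %| a)%Z.
Proof.
move=> b0; have bR0 : b%:~R != 0 :> R by rewrite intr_eq0.
apply/idP/idP => [/intrP[c /(canRL (divfK bR0))]|/dvdzP[c ->]].
  by rewrite -intrM => /intr_inj ->; rewrite dvdz_mull.
by rewrite intrM mulfK // intr_int.
Qed.

Section CharacterSum.
Variables (R : realType) (d : nat) (A L U : 'M[int]_d) (delta : 'rV[int]_d).
Hypotheses (Lu : L \in unitmx) (Uu : U \in unitmx).
Hypothesis AE : A = L *m diag_mx delta *m U.
Hypothesis A0 : \det A != 0.

(** [U] permutes Z^d, so A Z^d is the image of diag(delta) Z^d under [L]. *)
Lemma lattice_dvdP (x : 'cV[int]_d) :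
  lattice A x <-> forall j, (delta 0%R j %| (invmx L *m x) j 0%R)%Z.
Proof.
split=> [[z _ <-] j|dvd].
  rewrite AE -!mulmxA mulKmx // mul_diag_mx mxE; exact: dvdz_mulr.
pose c : 'cV[int]_d := \col_j ((invmx L *m x) j 0%R %/ delta 0%R j)%Z.
exists (invmx U *m c) => //.
rewrite AE -mulmxA mulKVmx // -mulmxA -[RHS](mulKVmx Lu); congr (_ *m _).
apply/matrixP => j i; rewrite mul_diag_mx mxE [c _ _]mxE ord1 mulrC.
exact: divzK.
Qed.

(** By transposition <x, (L^-1)^T v> = <L^-1 x, v>. The form [*+ k j] turns the character into a
    product of powers. *)
Lemma inner_dual_rep (x : 'cV[int]_d) (k : 'I_d -> nat) :
  inner (map_mx intr x) (dual_rep R d L delta k) =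
  \sum_j ((invmx L *m x) j 0)%:~R / (delta 0 j)%:~R *+ k j.
Proof.
have -> : inner (map_mx intr x) (dual_rep R d L delta k) =
    ((map_mx intr x)^T *m dual_rep R d L delta k) 0 0.
  by rewrite mxE; apply: eq_bigr => i _; rewrite [(_^T)%R _ _]mxE.
rewrite /dual_rep mulmxA -map_trmx -trmx_mul -map_mxM mxE.
apply: eq_bigr => j _.
rewrite [(_^T)%R _ _]mxE [map_mx _ _ _ _]mxE [(\col__ _) _ _]mxE.
by rewrite mulrCA mulr_natl.
Qed.

Lemma character_sum (M : nat) (x : 'cV[int]_d) :
  (forall j, `|delta 0%R j| <= M)%N ->
  \sum_(k : {ffun 'I_d -> 'I_M} | [forall j, k j < `|delta 0%R j|]%N)
    expi2pi R (inner (map_mx intr x) (dual_rep R d L delta (fun j => k j))) =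
  if x \in lattice A then `|\det A|%N%:R else 0.
Proof.
move=> leM; have delta0 := Smith_diag_neq0 d A L U delta Lu Uu AE A0.
(* The sum will split into geometric sums of [q j], a root of unity of order dividing |delta_j| that
   is 1 exactly when delta_j divides (L^-1 x)_j. *)
pose q j := expi2pi R (((invmx L *m x) j 0)%:~R / (delta 0 j)%:~R).
have q_eq1 j : (q j == 1) = (delta 0%R j %| (invmx L *m x) j 0%R)%Z.
  by rewrite -(ratio_intP R) //; apply/eqP/idP => /expi2pi_eq1.
have q_root j : q j ^+ `|delta 0%R j|%N = 1.
  rewrite -expi2piMn; apply/expi2pi_eq1.
  rewrite -mulr_natr pmulrn abszEsg intrM mulrCA divfK ?intr_eq0 //.
  by rewrite rpredM ?intr_int.
transitivity (\prod_j \sum_(l < `|delta 0%R j|%N) q j ^+ l).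
  (* Each range is widened to ['I_M], with a condition, so that the product of sums distributes over
     finite functions. *)
  under [RHS]eq_bigr => j _ do
    rewrite (big_ord_widen _ (fun l => q j ^+ l) (leM j)).
  rewrite bigA_distr_big_dep /=; apply: eq_big => [k|k _].
    by apply/forallP/familyP => h j; have := h j.
  rewrite inner_dual_rep expi2pi_sum; apply: eq_bigr => j _.
  by rewrite expi2piMn.
under eq_bigr do rewrite sum_root_of_unity // q_eq1.
case: ifPn => [/set_mem/lattice_dvdP xA|].
  under eq_bigr do rewrite xA.
  by rewrite -natr_prod (Smith_diag_det _ _ _ _ _ Lu Uu AE).
move=> /negP xNA.
have [j jN|all_dvd] :=
  pickP [pred j | ~~ (delta 0%R j %| (invmx L *m x) j 0%R)%Z].
  by rewrite (bigD1 j) //= (negPf jN) mul0r.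
by case: xNA; apply/mem_set/lattice_dvdP => j; have /negbFE := all_dvd j.
Qed.

End CharacterSum.

(** * Finite-support sums as sums over finite types *)

Lemma fsbig_fin_bij (V : nmodType) (T : finType) (J : choiceType) (P : pred T)
    (h : T -> J) (Q : set J) (F : J -> V) : set_bij [set` P] Q h ->
  \sum_(j \in Q) F j = \sum_(i | P i) F (h i).
Proof.
move=> hPQ; rewrite (@reindex_fsbig _ _ _ _ _ h [set` P] Q F hPQ).
apply/esym/bigfs => [|i _]; first exact: index_enum_uniq.
by rewrite mem_index_enum.
Qed.

(** [Q] may be infinite, but only the finitely many values of [h] have nonempty fibres; [r] lists
    those in [Q]. *)
Lemma fsbig_fibers (V : nmodType) (T : finType) (J : choiceType) (P : pred T)
    (h : T -> J) (Q : set J) (F : T -> V) :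
  \sum_(j \in Q) \sum_(i | P i && (h i == j)) F i =
  \sum_(i | P i && (h i \in Q)) F i.
Proof.
pose r := [seq j <- undup (codom h) | j \in Q].
have r_uniq : uniq r by rewrite filter_uniq ?undup_uniq.
have mem_r j : (j \in r) = (j \in Q) && (j \in codom h).
  by rewrite mem_filter mem_undup.
rewrite (fsbigE r) //=; last 2 first.
- by move=> j /=; rewrite mem_r => /andP[/set_mem].
- move=> j /mem_set Qj; rewrite mem_r Qj /= => jh.
  by apply: big1 => i /andP[_ /eqP hi]; case/negP: jh; rewrite -hi codom_f.
rewrite (exchange_big_dep (fun i => P i && (h i \in Q))) /=; last first.
  by move=> j i Qj /andP[-> /eqP->].
apply: eq_bigr => i /andP[Pi Qi].
rewrite big_mkcond (bigD1_seq (h i)) //=; last first.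
  by rewrite mem_r Qi codom_f.
rewrite Qi Pi eqxx big1 ?addr0 // => j; rewrite eq_sym => /negPf->.
by rewrite !andbF.
Qed.

Lemma big_prod_bool (S : Type) (idx : S) (op : Monoid.com_law idx) (I : finType)
    (F : I * bool -> S) :
  \big[op/idx]_p F p = \big[op/idx]_i op (F (i, true)) (F (i, false)).
Proof.
transitivity (\big[op/idx]_i \big[op/idx]_b F (i, b)).
  by rewrite pair_bigA; apply: eq_bigr => -[].
by apply: eq_bigr => i _; rewrite big_bool.
Qed.

(** * Exponent vectors as pairs (x, y) *)

Section SignedExponents.
Variables (d n : nat).
Implicit Types (a : {ffun 'I_d * bool -> 'I_n.+1}) (x : 'cV[int]_d).

(* (i, true) stands for the factor e(xi_i), (i, false) for e(-xi_i). *)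
Definition net a : 'cV[int]_d :=
  \col_i ((a (i, true))%:Z - (a (i, false))%:Z).

Definition overlap a : 'cV[nat]_d := \col_i minn (a (i, true)) (a (i, false)).

(** In this form over the naturals, a negative or half-integral index simply admits no [y]. *)
Lemma weak_compositions_halfE x y :
  weak_compositions d ((n%:R - (norm1 x)%:R) / 2) y <->
  (norm1 x + (norm1n y).*2)%N = n.
Proof.
rewrite /weak_compositions /=.
have two0 : 2 != 0 :> rat by [].
split=> [/(canLR (divfK two0))/eqP|<-].
  rewrite eq_sym subr_eq addrC -natrM -natrD eqr_nat muln2 => /eqP ->//.
by rewrite natrD addrC addKr -muln2 natrM mulfK.
Qed.

(** A pair (p, q) is determined by p - q and min(p, q), and p + q = |p - q| + 2 min(p, q). *)
Lemma overlap_bij x :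
  set_bij [set` [pred a : {ffun 'I_d * bool -> 'I_n.+1} |
                   (\sum_p a p == n)%N && (net a == x)]]
    (weak_compositions d ((n%:R - (norm1 x)%:R) / 2)) overlap.
Proof.
have norm_overlap (a : {ffun 'I_d * bool -> 'I_n.+1}) :
    (norm1 (net a) + (norm1n (overlap a)).*2 = \sum_p a p)%N.
  rewrite big_prod_bool -muln2 big_distrl -big_split /=.
  by apply: eq_bigr => i _; rewrite !mxE; lia.
split=> [a /andP[/eqP an /eqP <-]|a b|y /weak_compositions_halfE nE].
- by apply/weak_compositions_halfE; rewrite norm_overlap.
- move=> /set_mem/andP[_ /eqP ax] /set_mem/andP[_ /eqP]; rewrite -ax.
  move=> /matrixP netE /matrixP overE; apply/ffunP => -[i s]; apply/val_inj.
  have := netE i 0; have := overE i 0; rewrite !mxE /=; case: s; lia.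
- have le_n i : (`|x i 0%R| + y i 0%R <= n)%N.
    have le_norm (y0 : 'cV[nat]_d) : (y0 i 0%R <= norm1n y0)%N.
      by rewrite /norm1n (bigD1 i) //= leq_addr.
    rewrite -nE; have := le_norm y; have := le_norm (absv x).
    by rewrite mxE -/(norm1 x); lia.
  (* Both exponents at i get y_i, and the one on the side of the sign of x_i also gets |x_i|; [le_n]
     keeps them below [n.+1]. *)
  pose f (p : 'I_d * bool) : nat :=
    (y p.1 0%R + (if (0 <= x p.1 0%R)%R == p.2 then `|x p.1 0%R|%N else 0))%N.
  have f_lt p : (f p < n.+1)%N by rewrite /f; have := le_n p.1; case: ifP; lia.
  pose a := [ffun p => Ordinal (f_lt p)] : {ffun 'I_d * bool -> 'I_n.+1}.
  have netE : net a = x.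
    apply/matrixP => i j; rewrite ord1 !mxE !ffunE /= /f /=.
    by case: (leP 0 (x i 0)) => /=; lia.
  have overE : overlap a = y.
    apply/matrixP => i j; rewrite ord1 !mxE !ffunE /= /f /=.
    by case: (leP 0 (x i 0)) => /=; lia.
  by exists a => //=; rewrite inE netE eqxx andbT -norm_overlap netE overE nE.
Qed.

(** Since |p - q| + min(p, q) = max(p, q), the two factorials in each coordinate are those of p and
    q up to order. *)
Lemma coef_overlapE (R : realType) (w : 'cV[R]_d) a :
  n`!%:R / ((vfact (absv (net a) + overlap a))%:R * (vfact (overlap a))%:R)
    * vpow w (absv (net a) + overlap a *+ 2) =
  n`!%:R * \prod_p (w p.1 0 ^+ a p / (a p)`!%:R).
Proof.
rewrite -mulrA; congr (_ * _).
rewrite big_prod_bool /vfact /vpow /=.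
rewrite !natr_prod -big_split /= -prodfV -big_split /=; apply: eq_bigr => i _.
rewrite mulr2n !mxE.
set p := nat_of_ord (a (i, true)); set q := nat_of_ord (a (i, false)).
have -> : (absz (p%:Z - q%:Z) + minn p q)%R = maxn p q by lia.
have -> : (absz (p%:Z - q%:Z) + (minn p q + minn p q))%R = (p + q)%N by lia.
have fact_neq0 m : m`!%:R != 0 :> R by rewrite pnatr_eq0 -lt0n fact_gt0.
rewrite exprD.
by case: (leqP p q) => _; field; rewrite !fact_neq0.
Qed.

End SignedExponents.

(** * Expansion of the power and conclusion *)

Lemma inner_cos2pi_exp (R : realType) (d n : nat) (w xi : 'cV[R]_d) :
  ((inner w (Defs.cos2pi xi) ^+ n)%:C)%C =
  2 ^- n * \sum_(a : {ffun 'I_d * bool -> 'I_n.+1} | (\sum_p a p == n)%N)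
    ((n`!%:R * \prod_p (w p.1 0 ^+ a p / (a p)`!%:R))%:C)%C
    * expi2pi R (inner (map_mx intr (net d n a)) xi).
Proof.
(* Each w_i cos(2 pi xi_i) is half the sum of two such terms, whence [2 ^- n]. *)
pose t (p : 'I_d * bool) : R[i] :=
  ((w p.1 0)%:C)%C * expi2pi R (if p.2 then xi p.1 0 else - xi p.1 0).
have -> : ((inner w (Defs.cos2pi xi) ^+ n)%:C)%C = 2 ^- n * (\sum_p t p) ^+ n.
  rewrite big_prod_bool rmorphXn /= -exprVn -exprMn mulr_sumr; congr (_ ^+ n).
  rewrite raddf_sum; apply: eq_bigr => i _ /=.
  rewrite /t /= -mulrDr expi2piDN mxE !rmorphM /= rmorph_nat.
  by rewrite mulrCA mulKf // pnatr_eq0.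
rewrite multinomial_theorem; congr (_ * _); apply: eq_bigr => a _.
rewrite rmorphM rmorph_nat /= -mulrA; congr (_ * _).
rewrite !big_prod_bool rmorph_prod expi2pi_sum -big_split /=.
apply: eq_bigr => i _.
rewrite !rmorphM /= !fmorphV !rmorph_nat !rmorphXn /=.
rewrite /t /= !exprMn -!expi2piMn !mxE.
rewrite intrB mulrBl mulrC expi2piD.
rewrite mulNrn -!pmulrn !mulr_natl; ring.
Qed.

(** [overlap] matches the fibre of [net] over x with the compositions y, so the double sum runs over
    the exponent vectors with [net] in [Q]. *)
Lemma sum_lattice_overlap (R : realType) (d n : nat) (w : 'cV[R]_d)
    (Q : set 'cV[int]_d) :
  \sum_(x \in Q)
    \sum_(y \in weak_compositions d ((n%:R - (norm1 x)%:R) / 2))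
      n`!%:R / ((vfact (absv x + y))%:R * (vfact y)%:R)
      * vpow w (absv x + y *+ 2) =
  \sum_(a : {ffun 'I_d * bool -> 'I_n.+1} |
        (\sum_p a p == n)%N && (net d n a \in Q))
    n`!%:R * \prod_p (w p.1 0 ^+ a p / (a p)`!%:R).
Proof.
rewrite -fsbig_fibers; apply: eq_fsbigr => x _.
rewrite (fsbig_fin_bij _ _ _ _ _ _ _ (overlap_bij d n x)).
by apply: eq_bigr => a /andP[_ /eqP <-]; rewrite coef_overlapE.
Qed.

Theorem theorem1p1 (R : realType) (d : nat) (A : 'M[int]_d) (hA : \det A != 0)
    (w : 'cV[R]_d) (n : nat) (hn : (1 <= n)%N) :
  \sum_(xi \in T_star R A) inner w (cos2pi_coset xi) ^+ n =
  `|\det A|%:~R / 2 ^+ n *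
  \sum_(x \in lattice A)
    \sum_(y \in weak_compositions d ((n%:R - (norm1 x)%:R) / 2))
      n`!%:R / ((vfact (absv x + y))%:R * (vfact y)%:R)
      * vpow w (absv x + y *+ 2).
Proof.
rewrite sum_lattice_overlap.
have [L [U [delta [Lu Uu AE]]]] := int_Smith_diag _ A.
pose M := \max_j `|delta 0%R j|%N.
have leM j : (`|delta 0%R j| <= M)%N by exact: leq_bigmax.
rewrite (fsbig_fin_bij _ _ _ _ _ _ _
  (T_star_bij R d A L U delta Lu Uu AE hA M leM)).
(* The characters are complex-valued, so the real identity is proved in [R[i]]. *)
apply: complexI; rewrite rmorphM /= !rmorph_sum mulr_sumr /=.
under eq_bigr => k _.
  rewrite (cos2pi_cosetE
    (xi' := dual_rep R d L delta (fun j => k j))); last first.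
    by exists 0 => //; rewrite map_mx0 addr0.
  rewrite inner_cos2pi_exp.
  over.
(* For fixed [a] the inner sum over the torus is now a full character sum, equal to |det A| or 0. *)
rewrite -mulr_sumr exchange_big /=.
under eq_bigr do rewrite -mulr_sumr (character_sum _ _ _ _ _ _ Lu Uu AE hA) //.
rewrite mulr_sumr [LHS](bigID (fun a => net d n a \in lattice A)) /=.
rewrite [X in _ + X]big1 ?addr0 => [|a /andP[_ /negPf->]];
  last by rewrite !mulr0.
apply: eq_bigr => a /andP[_ ->].
rewrite !rmorphM fmorphV rmorphXn /= !rmorph_nat; ring.
Qed.
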